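(* Let $\mathcal{C}$ be a finite inverse category. Then every Reedy fibrant functor $X : \mathcal{C} \to \mathcal{U}$ has a fibrant limit.
   Context: We work internally in a two-level type theory: there are fibrant types (with fibrant universe $\mathcal{U}$ and fibrant equality $=$) and strict types (with strict universe $\mathcal{U}^{\mathrm{s}}$ and strict equality $=_{\mathrm{s}}$, satisfying UIP and function extensionality), every fibrant type coercing to a strict type. Categories are strict categories (category laws hold up to strict equality). A category is finite if its type of objects is strictly isomorphic to a strict finite ordinal $\mathsf{Fin}^{\mathrm{s}}(n)$ for some strict natural number $n$. A category $\mathcal{C}$ is an inverse category if there is a functor $\varphi : \mathcal{C} \to (\mathbb{N}^{\mathrm{s}})^{\mathrm{op}}$ (where $(\mathbb{N}^{\mathrm{s}})^{\mathrm{op}}(n,m) :\equiv n >^{\mathrm{s}} m$) which creates identities: if $f : \mathcal{C}(x,y)$ and $\varphi_x =_{\mathrm{s}} \varphi_y$, then $x =_{\mathrm{s}} y$ and $f$ is (transported to) the identity. For an object $z$, the reduced coslice $z /\!\!/ \mathcal{C}$ is the full subcategory of the coslice $z/\mathcal{C}$ on the non-identity arrows out of $z$, with forgetful functor $\mathsf{forget} : z /\!\!/ \mathcal{C} \to \mathcal{C}$. For $X : \mathcal{C} \to \mathcal{U}$, the matching object $M^X_z$ is the (strict, not necessarily fibrant) limit of $z /\!\!/ \mathcal{C} \xrightarrow{\mathsf{forget}} \mathcal{C} \xrightarrow{X} \mathcal{U} \subset \mathcal{U}^{\mathrm{s}}$. A map $p : E \to B$ is a fibration if there is $F : B \to \mathcal{U}$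 with each fibre of $p$ over $b$ strictly isomorphic to $F(b)$. $X$ is Reedy fibrant if for all $z$ the canonical map $X_z \to M^X_z$ is a fibration. $X$ has a fibrant limit if its limit in $\mathcal{U}^{\mathrm{s}}$ (the type of natural transformations from the constant functor $1$ to $X$) is strictly isomorphic to a fibrant type.
   Formalization: In the definition of inverse category, the arrows n → m of the opposite of the natural numbers are taken to be n ≥ m instead of the printed n > m, because with strict inequality there are no identity arrows and the target is not a category. *)

(* Defs.v *)
From mathcomp Require Import all_boot.
From Stdlib Require Import Eqdep FunctionalExtensionality.

Set Implicit Arguments.
Unset Strict Implicit.
Unset Printing Implicit Defensive.

(* The strict level is that of Rocq itself: strict types are the inhabitants
   of [Type] and strict equality is [eq], with UIP and function extensionality
   as provided by the two Stdlib files required above.  The fibrant level is a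
   universe a la Tarski inside it (see [two_level]).  Existence and isomorphism
   are data, as they are in type theory: the notions below that involve them
   live in [Type], not in [Prop]. *)

Record strict_iso (A B : Type) : Type := StrictIso {
  iso_to : A -> B;
  iso_from : B -> A;
  iso_toK : cancel iso_to iso_from;
  iso_fromK : cancel iso_from iso_to
}.

(* One universe of fibrant types, with its coercion [El] to strict types.
   The coercion preserves 1, Sigma and Pi up to strict isomorphism; the
   fibrant =, 0, + and N are only required to eliminate into fibrant families,
   so they need not agree with their strict counterparts.  Computation rules
   hold up to strict equality.  Neither univalence nor a code for a smaller
   universe is assumed: this describes any level of a hierarchy of fibrant
   universes, univalent or not. *)
Record two_level : Type := TwoLevel {
  U : Type;
  El : U -> Type;

  f_unit : U;
  f_unitE : strict_iso (El f_unit) unit;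
  f_sigma : forall A : U, (El A -> U) -> U;
  f_sigmaE : forall (A : U) (B : El A -> U),
    strict_iso (El (f_sigma B)) {a : El A & El (B a)};
  f_pi : forall A : U, (El A -> U) -> U;
  f_piE : forall (A : U) (B : El A -> U),
    strict_iso (El (f_pi B)) (forall a : El A, El (B a));

  f_eq : forall A : U, El A -> El A -> U;
  f_refl : forall (A : U) (a : El A), El (f_eq a a);
  f_J : forall (A : U) (a : El A) (P : forall b : El A, El (f_eq a b) -> U),
    El (P a (f_refl a)) -> forall (b : El A) (p : El (f_eq a b)), El (P b p);
  f_J_refl : forall (A : U) (a : El A)
      (P : forall b : El A, El (f_eq a b) -> U) (d : El (P a (f_refl a))),
    f_J d (f_refl a) = d;

  f_empty : U;
  f_empty_elim : forall P : El f_empty -> U, forall x : El f_empty, El (P x);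

  f_sum : U -> U -> U;
  f_inl : forall A B : U, El A -> El (f_sum A B);
  f_inr : forall A B : U, El B -> El (f_sum A B);
  f_sum_elim : forall (A B : U) (P : El (f_sum A B) -> U),
    (forall a, El (P (f_inl B a))) -> (forall b, El (P (f_inr A b))) ->
    forall x, El (P x);
  f_sum_elim_inl : forall (A B : U) (P : El (f_sum A B) -> U)
      (l : forall a, El (P (f_inl B a))) (r : forall b, El (P (f_inr A b))) a,
    f_sum_elim l r (f_inl B a) = l a;
  f_sum_elim_inr : forall (A B : U) (P : El (f_sum A B) -> U)
      (l : forall a, El (P (f_inl B a))) (r : forall b, El (P (f_inr A b))) b,
    f_sum_elim l r (f_inr A b) = r b;

  f_nat : U;
  f_zero : El f_nat;
  f_succ : El f_nat -> El f_nat;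
  f_nat_elim : forall P : El f_nat -> U,
    El (P f_zero) -> (forall n, El (P n) -> El (P (f_succ n))) ->
    forall n, El (P n);
  f_nat_elim_zero : forall (P : El f_nat -> U) (z : El (P f_zero))
      (s : forall n, El (P n) -> El (P (f_succ n))),
    f_nat_elim z s f_zero = z;
  f_nat_elim_succ : forall (P : El f_nat -> U) (z : El (P f_zero))
      (s : forall n, El (P n) -> El (P (f_succ n))) n,
    f_nat_elim z s (f_succ n) = s n (f_nat_elim z s n)
}.

Record category : Type := Category {
  ob :> Type;
  hom : ob -> ob -> Type;
  idm : forall x, hom x x;
  comp : forall x y z, hom y z -> hom x y -> hom x z;
  comp_idl : forall x y (f : hom x y), comp (idm y) f = f;
  comp_idr : forall x y (f : hom x y), comp f (idm x) = f;
  comp_assoc : forall x y z w (h : hom z w) (g : hom y z) (f : hom x y),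
    comp h (comp g f) = comp (comp h g) f
}.
Arguments hom {c} _ _.
Arguments idm {c} _.
Arguments comp {c x y z} _ _.

Record functor (C D : category) : Type := Functor {
  fob :> C -> D;
  fmap : forall x y : C, hom x y -> hom (fob x) (fob y);
  fmap_id : forall x : C, fmap (idm x) = idm (fob x);
  fmap_comp : forall (x y z : C) (g : hom y z) (f : hom x y),
    fmap (comp g f) = comp (fmap g) (fmap f)
}.
Arguments fmap {C D} _ {x y} _.

Definition comp_functor (C D E : category) (G : functor D E) (F : functor C D) :
  functor C E.
Proof.
refine (@Functor C E (fun x => G (F x)) (fun x y f => fmap G (fmap F f)) _ _).
- by move=> x; rewrite !fmap_id.
- by move=> x y z g f; rewrite !fmap_comp.
Defined.

Record nat_trans (C D : category) (F G : functor C D) : Type := NatTrans {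
  component :> forall x : C, hom (F x) (G x);
  naturality : forall (x y : C) (f : hom x y),
    comp (component y) (fmap F f) = comp (fmap G f) (component x)
}.

Definition const_functor (C D : category) (d : D) : functor C D.
Proof.
refine (@Functor C D (fun=> d) (fun _ _ _ => idm d) _ _).
- by [].
- by move=> *; rewrite comp_idl.
Defined.

Definition strict_types : category :=
  @Category Type (fun A B => A -> B) (fun A a => a) (fun A B C g f a => g (f a))
    (fun _ _ _ => erefl) (fun _ _ _ => erefl) (fun _ _ _ _ _ _ _ => erefl).

Definition fibrant_types (T : two_level) : category :=
  @Category (U T) (fun A B => El A -> El B) (fun A a => a)
    (fun A B C g f a => g (f a))
    (fun _ _ _ => erefl) (fun _ _ _ => erefl) (fun _ _ _ _ _ _ _ => erefl).

Definition fibrant_incl (T : two_level) : functor (fibrant_types T) strict_types :=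
  @Functor (fibrant_types T) strict_types (@El T) (fun _ _ f => f)
    (fun _ => erefl) (fun _ _ _ _ _ => erefl).

Definition strict_limit (C : category) (X : functor C strict_types) : Type :=
  nat_trans (const_functor C (unit : strict_types)) X.

Definition finite_category (C : category) : Type :=
  {n : nat & strict_iso C 'I_n}.

Definition is_identity (C : category) (x y : C) (f : hom x y) : Prop :=
  exists e : x = y, f = eq_rect x (hom x) (idm x) y e.

(* The opposite of the poset of natural numbers: a unique arrow from n to m
   exactly when n >= m. *)
Definition nat_op : category.
Proof.
refine (@Category nat (fun n m => n >= m) leqnn
          (fun _ _ _ g f => leq_trans g f) _ _ _);
by move=> *; apply: bool_irrelevance.
Defined.

Record inverse_category (C : category) : Type := InverseCategory {
  degree : functor C nat_op;
  creates_identities : forall (x y : C) (f : hom x y),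
    degree x = degree y -> is_identity f
}.

Lemma eq_sig_UIP (A B : Type) (f : A -> B) (b : B) (u v : {x : A | f x = b}) :
  sval u = sval v -> u = v.
Proof.
case: u v => [x p] [y q] /= e; move: p q; rewrite e => p q.
by rewrite (UIP _ _ _ p q).
Qed.

Definition coslice (C : category) (z : C) : category.
Proof.
refine (@Category {y : C & hom z y}
  (fun a b => {h : hom (projT1 a) (projT1 b) | comp h (projT2 a) = projT2 b})
  (fun a => exist _ (idm (projT1 a)) (comp_idl (projT2 a)))
  (fun a b c k h => exist _ (comp (sval k) (sval h)) _) _ _ _).
Unshelve.
- by move=> a b f; apply/eq_sig_UIP/comp_idl.
- by move=> a b f; apply/eq_sig_UIP/comp_idr.
- by move=> a b c d h g f; apply/eq_sig_UIP/comp_assoc.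
- by rewrite -comp_assoc (svalP h) (svalP k).
Defined.

Definition coslice_forget (C : category) (z : C) : functor (coslice z) C :=
  @Functor (coslice z) C (fun a => projT1 a) (fun _ _ h => sval h)
    (fun _ => erefl) (fun _ _ _ _ _ => erefl).

Definition full_subcategory (C : category) (P : C -> Prop) : category :=
  @Category {x : C | P x} (fun x y => hom (sval x) (sval y))
    (fun x => idm (sval x)) (fun _ _ _ g f => comp g f)
    (fun _ _ f => comp_idl f) (fun _ _ f => comp_idr f)
    (fun _ _ _ _ h g f => comp_assoc h g f).

Definition subcategory_incl (C : category) (P : C -> Prop) :
    functor (full_subcategory P) C :=
  @Functor (full_subcategory P) C (fun x => sval x) (fun _ _ f => f)
    (fun _ => erefl) (fun _ _ _ _ _ => erefl).

Definition reduced_coslice (C : category) (z : C) : category :=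
  @full_subcategory (coslice z) (fun a => ~ is_identity (projT2 a)).

Definition forget (C : category) (z : C) : functor (reduced_coslice z) C :=
  comp_functor (coslice_forget z) (subcategory_incl _).

Section Fibrancy.
Variable T : two_level.

Definition is_fibration (E B : Type) (p : E -> B) : Type :=
  {F : B -> U T & forall b : B, strict_iso {e : E | p e = b} (El (F b))}.

Variables (C : category) (X : functor C (fibrant_types T)).

Definition matching_object (z : C) : Type :=
  strict_limit (comp_functor (fibrant_incl T) (comp_functor X (forget z))).

Definition matching_map (z : C) (x : El (X z)) : matching_object z.
Proof.
refine (@NatTrans (reduced_coslice z) strict_types
  (const_functor _ (unit : strict_types))
  (comp_functor (fibrant_incl T) (comp_functor X (forget z)))
  (fun a _ => fmap X (projT2 (sval a)) x) _).
move=> a b h; apply: functional_extensionality => _ /=.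
have e := fmap_comp X (sval h) (projT2 (sval a)).
by rewrite (svalP h) in e; rewrite e.
Defined.

Definition reedy_fibrant : Type :=
  forall z : C, is_fibration (@matching_map z).

Definition has_fibrant_limit : Type :=
  {L : U T & strict_iso (strict_limit (comp_functor (fibrant_incl T) X)) (El L)}.

End Fibrancy.

(* Main.v *)
(** Objects are added one at a time in order of increasing degree.  If [z] has
    maximal degree among a cosieve [P] of objects, then every non-identity
    arrow out of [z] lands in [Q = P - z], no arrow goes from [Q] to [z], and
    [z] has no endomorphism but its identity.  Hence a cone over [P] is a cone
    [s] over [Q] together with a point of [X z] whose matching data is the one
    given by [s].  These points form a fibre of the matching map, so the limit
    over [P] is a Sigma-type of fibrant types. *)

From mathcomp Require Import all_boot.
From Stdlib Require Import Eqdep FunctionalExtensionality.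
Require Import Defs.

Set Implicit Arguments.
Unset Strict Implicit.
Unset Printing Implicit Defensive.

Definition strict_iso_sym (A B : Type) (i : strict_iso A B) : strict_iso B A :=
  StrictIso (iso_fromK i) (iso_toK i).

Definition strict_iso_trans (A B D : Type) (i : strict_iso A B)
    (j : strict_iso B D) : strict_iso A D :=
  StrictIso (can_comp (iso_toK j) (iso_toK i))
    (can_comp (iso_fromK i) (iso_fromK j)).

Lemma sigma_iso (A A' : Type) (B : A -> Type) (B' : A' -> Type)
    (i : strict_iso A' A)
    (j : forall a', strict_iso (B (iso_to i a')) (B' a')) :
  strict_iso {a : A & B a} {a' : A' & B' a'}.
Proof.
case: i j => f g fK gK /= j.
pose to (u : {a : A & B a}) : {a' : A' & B' a'} :=
  existT _ (g (projT1 u))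
    (iso_to (j _) (eq_rect_r B (projT2 u) (gK (projT1 u)))).
pose from (u : {a' : A' & B' a'}) : {a : A & B a} :=
  existT _ (f (projT1 u)) (iso_from (j _) (projT2 u)).
exists to from.
- case=> a b; rewrite /to /from /= iso_toK.
  by move: (f (g a)) (gK a) => c e; case: _ / e b.
- case=> a' b'; rewrite /to /from /=.
  (* No triangle identity relates [gK (f a')] to [fK a']. Once the base point is identified with
     [a'], the first becomes a loop, which UIP removes. *)
  move: (g (f a')) (gK (f a')) (fK a') => a'' e e'.
  by move: e; rewrite e' => e; rewrite (UIP_refl _ _ e) iso_fromK.
Qed.

Section Limits.
Variables (C : category) (X : functor C strict_types).

Definition cone (s : forall x, X x)
    (sP : forall (x y : C) (f : hom x y), fmap X f (s x) = s y) :
  strict_limit X :=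
  @NatTrans C strict_types (const_functor C (unit : strict_types)) X
    (fun x _ => s x)
    (fun x y f => functional_extensionality _ _ (fun _ => esym (sP x y f))).

Lemma cone_natural (s : strict_limit X) (x y : C) (f : hom x y) :
  fmap X f (s x tt) = s y tt.
Proof. by have /(congr1 (@^~ tt)) := naturality s f. Qed.

Lemma cone_ext (s t : strict_limit X) : (forall x, s x tt = t x tt) -> s = t.
Proof.
case: s t => [s sN] [t tN] /= st.
have e : s = t.
  apply: functional_extensionality_dep => x.
  by apply: functional_extensionality => -[]; apply: st.
case: _ / e tN {st} => tN; congr NatTrans.
do 3 (apply: functional_extensionality_dep => ?); exact: UIP.
Qed.

End Limits.

Lemma full_strict_limit (C : category) (P : C -> Prop) (allP : forall x, P x)
    (X : functor C strict_types) :
  strict_iso (strict_limit X)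
    (strict_limit (comp_functor X (subcategory_incl P))).
Proof.
pose to (s : strict_limit X) :=
  @cone _ (comp_functor X (subcategory_incl P)) (fun a => s (sval a) tt)
    (fun _ _ f => cone_natural s f).
pose from (t : strict_limit (comp_functor X (subcategory_incl P))) :=
  @cone _ X (fun x => t (exist _ x (allP x)) tt)
    (fun x y f => @cone_natural _ _ t (exist _ x (allP x))
                 (exist _ y (allP y)) f).
exists to from => [s|t]; apply: cone_ext => //= -[x Px] /=.
(* The proofs [allP x] and [Px] may differ, but [idm x] is an arrow between the two objects, so
   naturality equates the components of [t]. *)
have := @cone_natural _ _ t (exist _ x (allP x)) (exist _ x Px) (idm x).
by rewrite /= (fmap_id X).
Qed.

Lemma is_identity_endo (C : category) (x : C) (f : hom x x) :
  is_identity f -> f = idm x.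
Proof. by case=> e ->; rewrite (UIP_refl _ _ e). Qed.

Section Fibrant.
Variable T : two_level.

Definition fibrant (A : Type) : Type := {L : U T & strict_iso A (El L)}.

(** Base case of the induction: it serves for cones over the empty subcategory. *)
Lemma fibrant_unit (A : Type) : A -> (forall a b : A, a = b) -> fibrant A.
Proof.
move=> a eqA; exists (f_unit T).
apply: strict_iso_trans (strict_iso_sym (f_unitE T)).
by exists (fun=> tt) (fun=> a) => [b|[]].
Qed.

Lemma fibrant_sigma (A : Type) (B : A -> Type) :
  fibrant A -> (forall a, fibrant (B a)) -> fibrant {a : A & B a}.
Proof.
move=> [L i] fibB; pose F a := projT1 (fibB a).
(* [f_sigma] takes a family over [El L], so the codes for [B] are reindexed along the inverse of
   [i]. *)
exists (f_sigma (fun l => F (iso_from i l))).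
apply: strict_iso_trans (strict_iso_sym (f_sigmaE _)).
exact: (sigma_iso (i := strict_iso_sym i) (fun l => projT2 (fibB _))).
Qed.

Lemma fibrant_iso (A B : Type) : strict_iso A B -> fibrant B -> fibrant A.
Proof. by move=> i [L j]; exists L; apply: strict_iso_trans j. Qed.

Section AddObject.
Variables (C : category) (X : functor C (fibrant_types T)).
Variables (P Q : pred C) (z : C).
Hypothesis Pz : P z.
Hypothesis subQP : forall x, Q x -> P x.
Hypothesis PcaseQ : forall x, P x -> {z = x} + {Q x}.
Hypothesis endo_z : forall f : hom z z, is_identity f.
Hypothesis out_z : forall x (f : hom z x), ~ is_identity f -> Q x.
Hypothesis into_z : forall x, hom x z -> Q x -> False.

Definition sub_ob (R : pred C) (x : C) (Rx : R x) : full_subcategory R :=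
  exist _ x Rx.

Local Notation subX R :=
  (comp_functor (fibrant_incl T) (comp_functor X (subcategory_incl R))).

(* [svalP] is opaque: only [proj2_sig] makes the objects below convert. *)
Definition restrict_cone (s : strict_limit (subX P)) : strict_limit (subX Q) :=
  @cone _ (subX Q) (fun x => s (sub_ob (subQP (proj2_sig x))) tt)
    (fun x y f => @cone_natural _ _ s (sub_ob (subQP (proj2_sig x)))
                    (sub_ob (subQP (proj2_sig y))) f).

Definition matching_cone (s : strict_limit (subX Q)) : matching_object X z :=
  @cone _ (comp_functor (fibrant_incl T) (comp_functor X (forget z)))
    (fun a => s (sub_ob (out_z (proj2_sig a))) tt)
    (fun a b h => @cone_natural _ _ s (sub_ob (out_z (proj2_sig a)))
                    (sub_ob (out_z (proj2_sig b))) (sval h)).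

(** This is literally the type for which [is_fibration] supplies a code. *)
Definition fibre_at (s : strict_limit (subX Q)) : Type :=
  {x : El (X z) | matching_map x = matching_cone s}.

Lemma matching_restrict (s : strict_limit (subX P)) :
  matching_map (X := X) (z := z) (s (sub_ob Pz) tt) =
    matching_cone (restrict_cone s).
Proof.
apply: cone_ext => a /=.
exact: (@cone_natural _ _ s (sub_ob Pz)
  (sub_ob (subQP (out_z (proj2_sig a)))) (projT2 (sval a))).
Qed.

(** An arrow from [z] into [Q] is not an identity, since [into_z] at [idm z] excludes [z] from [Q].
    It is thus an object of the reduced coslice, where the equation of matching data can be
    evaluated. *)
Lemma matching_fibre (s : strict_limit (subX Q)) (x : El (X z)) :
  matching_map x = matching_cone s ->
  forall (y : C) (f : hom z y) (Qy : Q y),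
  fmap X f x = s (sub_ob Qy) tt.
Proof.
move=> e y f Qy.
have nf : ~ is_identity f.
  by case=> zy _; apply: (@into_z z (idm z)); rewrite zy.
have /= := congr1 (fun m : matching_object X z =>
  m (exist _ (existT _ y f) nf) tt) e.
by rewrite (bool_irrelevance (out_z nf) Qy).
Qed.

(** [PcaseQ] is an informative sum because a point of [X y], not a proof, is chosen by cases on
    it. *)
Definition extend_at (s : strict_limit (subX Q)) (x : El (X z)) (y : C)
    (Py : P y) : El (X y) :=
  match PcaseQ Py with
  | left zy => eq_rect z (fun y => El (X y)) x y zy
  | right Qy => s (sub_ob Qy) tt
  end.

(** Four cases for the ends of [f]: from [z] to [z] it is the identity, from [z] to [Q] the matching
    equation applies, from [Q] to [z] there is no arrow, and inside [Q] the cone [s] is natural. *)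
Lemma extend_at_natural (s : strict_limit (subX Q)) (x : El (X z))
    (xP : matching_map x = matching_cone s)
    (a b : full_subcategory P) (f : hom a b) :
  fmap X (f : hom (sval a) (sval b)) (extend_at s x (proj2_sig a)) =
    extend_at s x (proj2_sig b).
Proof.
case: a b f => [a Pa] [b Pb] /= f; rewrite /extend_at.
case: (PcaseQ Pa) => [za|Qa]; case: (PcaseQ Pb) => [zb|Qb].
- case: _ / za in f *; case: _ / zb in f *.
  by rewrite (is_identity_endo (endo_z f)) fmap_id.
- by case: _ / za in f *; apply: matching_fibre.
- by case: _ / zb in f *; case: (into_z f).
- exact: (@cone_natural _ _ s (sub_ob Qa) (sub_ob Qb) f).
Qed.

Definition extend_cone (u : {s : strict_limit (subX Q) & fibre_at s}) :
  strict_limit (subX P) :=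
  @cone _ (subX P)
    (fun a => extend_at (projT1 u) (sval (projT2 u)) (proj2_sig a))
    (extend_at_natural (proj2_sig (projT2 u))).

Lemma limit_add_object :
  strict_iso (strict_limit (subX P)) {s : strict_limit (subX Q) & fibre_at s}.
Proof.
exists (fun s => existT _ (restrict_cone s) (exist _ _ (matching_restrict s)))
  extend_cone.
- move=> s; apply: cone_ext => -[y Py] /=; rewrite /extend_at.
  case: (PcaseQ Py) => [zy|Qy] /=; last first.
    by rewrite (bool_irrelevance (subQP _) Py).
  by case: _ / zy in Py *; rewrite (bool_irrelevance Pz Py).
- move=> [s [x xP]].
  have e : restrict_cone (extend_cone (existT _ s (exist _ x xP))) = s.
    apply: cone_ext => -[y Qy] /=; rewrite /extend_at.
    case: (PcaseQ _) => [zy|Qy']; last by rewrite (bool_irrelevance Qy' Qy).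
    by case: (@into_z z (idm z)); rewrite zy.
  (* The fibre depends on the restricted cone, so the proof in it is abstracted before [e] is used;
     only the points at [z] are left to compare. *)
  move: (matching_restrict _); move: (restrict_cone _) e => _ -> xP'.
  congr existT; apply: eq_sig_UIP => /=; rewrite /extend_at.
  case: (PcaseQ Pz) => [zz|Qz]; first by rewrite (UIP_refl _ _ zz).
  by case: (into_z (idm z) Qz).
Qed.

Lemma fibrant_add_object :
  is_fibration T (@matching_map T C X z) ->
  fibrant (strict_limit (subX Q)) -> fibrant (strict_limit (subX P)).
Proof.
move=> [F isoF] fibQ; apply: fibrant_iso limit_add_object _.
by apply: fibrant_sigma fibQ _ => s; exists (F (matching_cone s)); apply: isoF.
Qed.

End AddObject.

Definition cosieve (C : category) (P : pred C) : Prop :=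
  forall x y : C, hom x y -> P x -> P y.

(** Strong induction on the cardinal of [A]. The cosieve is given by a set of indices, so that
    cardinals and maxima are those of finite sets. *)
Lemma fibrant_cosieve_limit (C : category) (invC : inverse_category C)
    (X : functor C (fibrant_types T)) (fibX : reedy_fibrant X)
    (n : nat) (i : strict_iso C 'I_n) (A : {set 'I_n}) :
  cosieve (fun x => iso_to i x \in A) ->
  fibrant (strict_limit (comp_functor (fibrant_incl T)
    (comp_functor X (subcategory_incl (fun x => iso_to i x \in A))))).
Proof.
have [m] := ubnP #|A|; elim: m A => // m IHm A; rewrite ltnS => leAm clA.
pose deg k := degree invC (iso_from i k).
have [k0 Ak0|A0] := pickP (mem A); last first.
  have noA (a : full_subcategory (fun x => iso_to i x \in A)) : False.
    by case: a => x; rewrite [_ \in _]A0.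
  apply: fibrant_unit => [|s t]; last by apply: cone_ext => a; case: (noA a).
  by apply: (cone (s := fun a => False_rect _ (noA a))) => a; case: (noA a).
pose k := [arg max_(j > k0 in A) deg j].
have [Ak max_k] : k \in A /\ forall j, j \in A -> deg j <= deg k.
  by rewrite /k; case: arg_maxnP.
pose z := iso_from i k.
have zk : iso_to i z = k by apply: iso_fromK.
have degP x y (f : hom x y) : degree invC y <= degree invC x :=
  fmap (degree invC) f.
have inA x : iso_to i x \in A -> degree invC x <= degree invC z.
  by move=> Ax; rewrite -[x](iso_toK i); apply: max_k.
(* Arrows do not raise the degree and [z] has the largest one, so both ends of [f] have equal degree
   and [creates_identities] applies. *)
have idz x (f : hom x z) : iso_to i x \in A -> is_identity f.
  move=> Ax; apply: (creates_identities (i := invC)).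
  by apply/eqP; rewrite eqn_leq inA // degP.
(* The target stays in the cosieve; if it were [z], [idz] would make [f] an identity. *)
have neqz x (f : hom z x) : ~ is_identity f -> iso_to i x \in A :\ k.
  move=> nf; rewrite !inE (clA _ _ f) ?zk // andbT.
  apply/eqP => xk; have xz : x = z by rewrite -[x](iso_toK i) xk.
  by case: _ / (esym xz) in f nf *; apply/nf/idz; rewrite zk.
have notAz x : iso_to i x \in A :\ k -> x <> z.
  by rewrite !inE => /andP[/eqP xk _] xz; apply: xk; rewrite xz.
apply: (@fibrant_add_object C X _ (fun x => iso_to i x \in A :\ k) z) => //.
- by rewrite zk.
- by move=> x /setD1P[].
- move=> x Ax; have [xk|xk] := eqVneq (iso_to i x) k; [left | right].
    by rewrite -[x](iso_toK i) xk.
  by rewrite !inE xk.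
- by move=> f; apply: idz; rewrite zk.
- move=> x f Akx; have [_ Ax] := setD1P Akx.
  by have [xz _] := idz _ f Ax; apply: notAz xz.
(* The smaller set is again a cosieve: an arrow leaving it could only end at [z], and would then be
   an identity, with source [z]. *)
apply: IHm => [|x y f Ax].
  by move: leAm; rewrite (cardsD1 k) Ak.
have [_ Ay] := setD1P Ax; rewrite !inE (clA _ _ f) // andbT.
apply/eqP => yk; have yz : y = z by rewrite -[y](iso_toK i) yk.
case: _ / (esym yz) in f yk *.
by have [xz _] := idz _ f Ay; apply: notAz xz.
Qed.

End Fibrant.

Theorem mainTheorem10 (T : two_level) (C : category)
    (finC : finite_category C) (invC : inverse_category C)
    (X : functor C (fibrant_types T)) (fibX : reedy_fibrant X) :
  has_fibrant_limit X.
Proof.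
case: finC => n i.
(* The cosieve of all indices gives back the whole category. *)
have allT x : iso_to i x \in [set: 'I_n] by rewrite inE.
apply: fibrant_iso (full_strict_limit allT _) _.
exact: fibrant_cosieve_limit.
Qed.
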